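(* Suppose $(X^1,T^1,\phi^1,|\phi^1|)$ and $(X^2,T^2,\phi^2,|\phi^2|)$ are equivalent substitution (dynamical) systems, with isomorphism $\tau$. If $(X^1,T^1,\phi^1,|\phi^1|)$ satisfies Property P, then so does $(X^2,T^2,\phi^2,|\phi^2|)$. Furthermore, for almost every $x\in X^1$, $\mathcal{O}(\tau x)=\mathcal{O}(x)$. In particular, if $\mathcal{O}(x)$ is almost everywhere constant up to conjugacy, then $\mathcal{O}(\tau x)$ is almost everywhere constant up to conjugacy and $[\mathcal{O}]_0(X^2)=[\mathcal{O}]_0(X^1)$.
   Context: $G_E$ is the connected Euclidean group of $\mathbb{R}^m$, the semidirect product of $SO(m)$ with $\mathbb{R}^m$; $g=(r,t)$ denotes the rotation $r$ about the origin followed by translation by $t$. A substitution (dynamical) system is a quadruple $(X,T,\phi,|\phi|)$ consisting of a compact metric space $X$ (metric $d$) with a continuous action $T:(g,x)\in G_E\times X\mapsto T^g x\in X$ of $G_E$, and a homeomorphism $\phi:X\to X$ such that $\phi(T^g x)=T^{\phi(g)}(\phi x)$ for all $x\in X$ and $g\in G_E$, where $\phi(g)$ is the conjugate of $g$ by the similarity of Euclidean space stretching about the origin by $|\phi|>1$ (so $\phi((r,t))=(r,|\phi|t)$). For $\epsilon>0$ and $x\in X$, $$S^\epsilon(x)=\{y\in X: d(\phi^n y,\phi^n x)<\epsilon\ \text{for all } n\ge0,\ \text{and } d(\phi^n y,\phi^n x)\to0 \text{ as } n\to\infty\},$$ $$R^\epsilon(x)=\{r\in SO(m): \text{there exists }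 t\text{ such that } T^{(r,t)}x\in S^\epsilon(x)\},$$ and $\mathcal{O}^\epsilon(x)$ is the subgroup of $SO(m)$ generated by $R^\epsilon(x)$. ''Almost every'' (or ''almost everywhere'') means outside a set of measure zero for every translation invariant Borel probability measure on the space. Equivalence: $(X^1,T^1,\phi^1,|\phi^1|)$ and $(X^2,T^2,\phi^2,|\phi^2|)$ are equivalent if there are subsets $Y_j\subset X^j$, invariant under $T^j$ and of measure zero for all translation invariant Borel probability measures on $X^j$, and a one-to-one, onto, Borel bimeasurable map (isomorphism) $\tau:X^1\setminus Y_1\to X^2\setminus Y_2$ such that $\tau\circ T^1=T^2\circ\tau$ and, for each $x\in X^1\setminus Y_1$, $\epsilon>0$ and $\epsilon'>0$, there exist $\tilde\epsilon>0$ and $\tilde\epsilon'>0$ such that $\tau[S^{\tilde\epsilon}(x)]\subset S^\epsilon(\tau x)$ and $\tau^{-1}[S^{\tilde\epsilon'}(\tau x)]\subset S^{\epsilon'}(x)$. Property P: for almost every $x$ there exists $\epsilon>0$ such that, if $0<\epsilon'<\epsilon$, then $\mathcal{O}^{\epsilon'}(x)=\mathcal{O}^\epsilon(x)$. If a substitution system satisfies Property P, $\mathcal{O}(x)$ denotes $\mathcal{O}^\epsilon(x)$ for $\epsilon$ sufficiently small (defined for almost every $x$). If the conjugacy class in $SO(m)$ of $\mathcal{O}(x)$ is almost everywhere constant, that conjugacy class is denoted $[\mathcal{O}]_0(X)$. *)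

(* Defs.v *)
From HB Require Import structures.
From mathcomp Require Import all_boot all_order all_algebra.
From mathcomp Require Import all_classical all_reals all_analysis.

Set Implicit Arguments.
Unset Strict Implicit.
Unset Printing Implicit Defensive.

Import Order.TTheory GRing.Theory Num.Theory.
Import numFieldNormedType.Exports.

Local Open Scope classical_set_scope.
Local Open Scope ring_scope.

Definition SO (R : realType) (m : nat) : set 'M[R]_m :=
  [set r | r *m r^T = 1%:M /\ \det r = 1].
Arguments SO : clear implicits.

Definition rotation (R : realType) (m : nat) : Type := set_type (SO R m).

HB.instance Definition _ (R : realType) (m : nat) :=
  Choice.copy (rotation R m) (set_type (SO R m)).
HB.instance Definition _ (R : realType) (m : nat) :=
  Topological.copy (rotation R m) (set_type (SO R m)).

Section rotation_group.
Context (R : realType) (m : nat).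
Implicit Types (r : rotation R m).

Definition rotation_mx r : 'M[R]_m := sval r.

Lemma rotation_mxP r : SO R m (rotation_mx r).
Proof. by apply: set_mem; case: r. Qed.

Lemma rotation_mx_inj : injective rotation_mx.
Proof. exact: val_inj. Qed.

Definition mk_rotation (A : 'M[R]_m) (AP : SO R m A) : rotation R m :=
  exist _ A (mem_set AP).

Lemma SO1 : SO R m 1%:M.
Proof. by split; rewrite ?trmx1 ?mulmx1 ?det1. Qed.

Lemma SOM (A B : 'M[R]_m) : SO R m A -> SO R m B -> SO R m (A *m B).
Proof.
move=> [AA dA] [BB dB]; split; last by rewrite det_mulmx dA dB mulr1.
by rewrite trmx_mul mulmxA -(mulmxA A) BB mulmx1.
Qed.

Lemma SOV (A : 'M[R]_m) : SO R m A -> SO R m A^T.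
Proof. by move=> [AA dA]; split; rewrite ?det_tr// trmxK (mulmx1C AA). Qed.

Definition rotation1 : rotation R m := mk_rotation SO1.
Definition rotationM r s : rotation R m :=
  mk_rotation (SOM (rotation_mxP r) (rotation_mxP s)).
Definition rotationV r : rotation R m := mk_rotation (SOV (rotation_mxP r)).

Let mulA : associative rotationM.
Proof. by move=> r s q; apply: rotation_mx_inj; rewrite /rotation_mx /= mulmxA. Qed.

Let mul1 : left_id rotation1 rotationM.
Proof. by move=> r; apply: rotation_mx_inj; rewrite /rotation_mx /= mul1mx. Qed.

Let mulx1 : right_id rotation1 rotationM.
Proof. by move=> r; apply: rotation_mx_inj; rewrite /rotation_mx /= mulmx1. Qed.

Let mulV : left_inverse rotation1 rotationV rotationM.
Proof.
move=> r; apply: rotation_mx_inj; rewrite /rotation_mx /=.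
by have [rr _] := rotation_mxP r; rewrite (mulmx1C rr).
Qed.

Let mulxV : right_inverse rotation1 rotationV rotationM.
Proof.
by move=> r; apply: rotation_mx_inj; rewrite /rotation_mx /=; have [] := rotation_mxP r.
Qed.

HB.instance Definition _ :=
  isGroup.Build (rotation R m) mulA mul1 mulx1 mulV mulxV.

End rotation_group.

(* The pair (r, t) is the motion v |-> r v + t, see [euclid_apply]; the group
   law is that of the semidirect product, not of the direct product. *)
Definition euclid (R : realType) (m : nat) : Type :=
  (rotation R m * 'cV[R]_m)%type.

HB.instance Definition _ (R : realType) (m : nat) :=
  Choice.copy (euclid R m) (rotation R m * 'cV[R]_m)%type.
HB.instance Definition _ (R : realType) (m : nat) :=
  Topological.copy (euclid R m) (rotation R m * 'cV[R]_m)%type.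

Section euclid_group.
Context (R : realType) (m : nat).
Implicit Types (g h : euclid R m) (r : rotation R m) (t v : 'cV[R]_m).

Definition Euclid r t : euclid R m := (r, t).

Definition translation t : euclid R m := Euclid 1%g t.

Definition euclid_apply g v : 'cV[R]_m := rotation_mx g.1 *m v + g.2.

Definition euclid1 : euclid R m := Euclid 1%g 0.
Definition euclidM g h : euclid R m :=
  Euclid (g.1 * h.1)%g (euclid_apply g h.2).
Definition euclidV g : euclid R m :=
  Euclid g.1^-1%g (- (rotation_mx g.1^-1%g *m g.2)).

Let mulA : associative euclidM.
Proof.
move=> g h k; rewrite /euclidM /Euclid /euclid_apply /= mulgA.
by rewrite mulmxDr mulmxA addrA.
Qed.

Let mul1 : left_id euclid1 euclidM.
Proof.
by move=> [r t]; rewrite /euclidM /Euclid /euclid_apply /= mul1g mul1mx addr0.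
Qed.

Let mulx1 : right_id euclid1 euclidM.
Proof.
by move=> [r t]; rewrite /euclidM /Euclid /euclid_apply /= mulg1 mulmx0 add0r.
Qed.

Let mulV : left_inverse euclid1 euclidV euclidM.
Proof.
by move=> [r t]; rewrite /euclidM /Euclid /euclid_apply /= mulVg subrr.
Qed.

Let mulxV : right_inverse euclid1 euclidV euclidM.
Proof.
move=> [r t]; rewrite /euclidM /Euclid /euclid_apply /= mulgV mulmxN mulmxA.
by have [-> _] := rotation_mxP r; rewrite mul1mx addNr.
Qed.

HB.instance Definition _ :=
  isGroup.Build (euclid R m) mulA mul1 mulx1 mulV mulxV.

Lemma euclid_applyM g h v :
  euclid_apply (g * h)%g v = euclid_apply g (euclid_apply h v).
Proof. by rewrite /euclid_apply /= mulmxDr mulmxA addrA. Qed.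

Definition dilate (s : R) g : euclid R m := Euclid g.1 (s *: g.2).

(* [dilate s g] is the conjugate of [g] by the similarity v |-> s v. *)
Lemma dilateE (s : R) g v : s != 0 ->
  euclid_apply (dilate s g) v = s *: euclid_apply g (s^-1 *: v).
Proof.
by move=> s0; rewrite /euclid_apply scalerDr -scalemxAr scalerA divff// scale1r.
Qed.

End euclid_group.

Definition homeomorphism (T U : topologicalType) (f : T -> U) : Prop :=
  continuous f /\ exists g : U -> T,
    [/\ cancel f g, cancel g f & continuous g].

(* Measurable types are pointed in the library, so spaces carrying Borel
   measures are taken nonempty, with an irrelevant distinguished point. *)
#[short(type="pmetricType")]
HB.structure Definition PointedMetric (K : numDomainType) :=
  {M of Metric K M & isPointed M}.

Record substitution_system (R : realType) (m : nat) := SubstitutionSystem {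
  space :> pmetricType R;
  space_compact : compact [set: space];
  act : euclid R m -> space -> space;
  act1 : forall x, act 1%g x = x;
  actM : forall g h x, act (g * h)%g x = act g (act h x);
  act_continuous :
    continuous (fun gx : euclid R m * space => act gx.1 gx.2);
  subst : space -> space;
  subst_homeomorphism : homeomorphism subst;
  stretch : R;
  stretch_gt1 : 1 < stretch;
  subst_act : forall g x, subst (act g x) = act (dilate stretch g) (subst x)
}.
Arguments subst {R m} X x : rename.

Definition borel_type (T : ptopologicalType) := g_sigma_algebraType (@open T).

Definition borel (T : ptopologicalType) : set (set T) := <<s @open T >>.

Section almost_everywhere.
Context (R : realType) (m : nat) (X : substitution_system R m).

Definition translation_invariant (mu : probability (borel_type X) R) : Prop :=
  forall (t : 'cV[R]_m) (A : set X), borel A ->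
    mu (act (translation t) @^-1` A) = mu A.

Definition null_set (Y : set X) : Prop :=
  forall mu : probability (borel_type X) R, translation_invariant mu ->
    mu.-negligible Y.

Definition almost_every (P : X -> Prop) : Prop := null_set (~` [set x | P x]).

Definition ae_constant (U : Type) (f : X -> U) : Prop :=
  exists c, almost_every (fun x => f x = c).

End almost_everywhere.

Section subgroups.
Context (G : groupType).

Definition generated (A : set G) : set G :=
  smallest [set H : set G | group_closed (mem H)] A.

Definition conjugacy_class (H : set G) : set (set G) :=
  [set K | exists g : G, K = [set (h ^ g)%g | h in H]].

End subgroups.

Section rotation_groups.
Context (R : realType) (m : nat) (X : substitution_system R m).
Implicit Types (x : X) (e : R).

Definition stable_set e x : set X :=
  [set y | (forall n, mdist (iter n (subst X) y) (iter n (subst X) x) < e) /\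
    (fun n => mdist (iter n (subst X) y) (iter n (subst X) x))
      @ \oo --> (0 : R)].

Definition rotations e x : set (rotation R m) :=
  [set r | exists t, stable_set e x (act (Euclid r t) x)].

Definition rotation_group e x : set (rotation R m) :=
  generated (rotations e x).

Definition stabilizes x : Prop :=
  exists2 e, 0 < e &
    forall e', 0 < e' -> e' < e -> rotation_group e' x = rotation_group e x.

(* The value of [rotation_group e x] for small e; junk unless [stabilizes x]. *)
Definition limit_group x : set (rotation R m) :=
  get [set H | \forall e \near 0^'+, rotation_group e x = H].

End rotation_groups.

Definition property_P (R : realType) (m : nat) (X : substitution_system R m) :=
  almost_every (@stabilizes R m X).

(* Junk unless the class of [limit_group x] is almost everywhere constant. *)
Definition rotation_class (R : realType) (m : nat)
    (X : substitution_system R m) : set (set (rotation R m)) :=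
  get [set C | almost_every (fun x : X => conjugacy_class (limit_group x) = C)].

(* [tau] only matters off [Y1]: direct images under it are images of the part
   of a set lying off [Y1], and preimages are restricted to the complement of
   [Y1].  The exceptional sets need not be Borel, so bimeasurability refers to
   the traces of the Borel sigma-algebras on their complements. *)
Record equivalence (R : realType) (m : nat) (X1 X2 : substitution_system R m)
    (Y1 : set X1) (Y2 : set X2) (tau : X1 -> X2) : Prop := Equivalence {
  equiv_invl : forall g x, Y1 x -> Y1 (act g x);
  equiv_invr : forall g y, Y2 y -> Y2 (act g y);
  equiv_nulll : null_set Y1;
  equiv_nullr : null_set Y2;
  equiv_bij : set_bij (~` Y1) (~` Y2) tau;
  equiv_borel : forall B, strace (@borel X2) (~` Y2) B ->
    strace (@borel X1) (~` Y1) (~` Y1 `&` tau @^-1` B);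
  equiv_borelV : forall A, strace (@borel X1) (~` Y1) A ->
    strace (@borel X2) (~` Y2) (tau @` A);
  equiv_act : forall g x, ~ Y1 x -> tau (act g x) = act g (tau x);
  equiv_stable : forall x e e', ~ Y1 x -> 0 < e -> 0 < e' ->
    exists d d' : R, [/\ 0 < d, 0 < d',
      tau @` (stable_set d x `\` Y1) `<=` stable_set e (tau x) &
      ~` Y1 `&` tau @^-1` stable_set d' (tau x) `<=` stable_set e' x]
}.

(* Main.v *)
(* A null exceptional set [N] need not be Borel, but it lies in a Borel null set
   for each invariant measure [mu]; redefining an equivariant map off [N] to be
   constant on that set makes it Borel, and the pushforward of [mu] is again an
   invariant probability.  Hence [tau] and its inverse carry null sets to null
   sets.  Pointwise, the inclusions between stable sets at all scales interleave
   the families of rotation groups at [x] and at [tau x], so that one is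
   eventually constant iff the other is, with the same value. *)
Require Import Defs.
From mathcomp Require Import all_boot all_order all_algebra.
From mathcomp Require Import all_classical all_reals all_analysis.

Set Implicit Arguments.
Unset Strict Implicit.
Unset Printing Implicit Defensive.

Import Order.TTheory GRing.Theory Num.Theory.
Import numFieldNormedType.Exports.

Local Open Scope classical_set_scope.
Local Open Scope ring_scope.

(* MathComp-Analysis has another [null_set]. *)
Local Notation null_set := Defs.null_set.

Lemma generatedS (G : groupType) (A B : set G) :
  A `<=` B -> generated A `<=` generated B.
Proof.
move=> AB h hA K [Kg BK]; apply: hA; split=> //.
exact: subset_trans BK.
Qed.

(** * Eventual value of the rotation groups at small scales *)

Section limit_groups.
Context (R : realType) (m : nat) (X : substitution_system R m).
Implicit Types (x : X) (H : set (rotation R m)).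

Lemma rotation_groupS x (e e' : R) :
  e <= e' -> rotation_group e x `<=` rotation_group e' x.
Proof.
move=> ee'; apply: generatedS => r [t [rt rt0]]; exists t; split=> // n.
exact: lt_le_trans (rt n) ee'.
Qed.

(** The filter [0^'+] is proper, so two eventual values are attained at a common [e] and coincide;
    [get] therefore has only one possible answer. *)
Lemma limit_groupE x H :
  (\forall e \near 0^'+, rotation_group e x = H) -> limit_group x = H.
Proof.
move=> xH; rewrite /limit_group; apply: get_unique => // K xK.
have [e [<- <-//]] : exists e : R, rotation_group e x = K /\ rotation_group e x = H.
by apply: (@filter_ex _ (0^'+)); near=> e; split; near: e.
Unshelve. all: by end_near. Qed.

Lemma stabilizes_near x H :
  (\forall e \near 0^'+, rotation_group e x = H) -> stabilizes x.
Proof.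
move=> [d /= d0 xH].
have xd e : 0 < e -> e < d -> rotation_group e x = H.
  by move=> e0 ed; apply: xH => //=; rewrite sub0r normrN gtr0_norm.
have d20 : 0 < d / 2 by rewrite divr_gt0.
have d2d : d / 2 < d by rewrite ltr_pdivrMr// ltr_pMr// ltr1n.
(* The witness lies strictly inside the radius, since [stabilizes] compares with the group at the
   witness itself. *)
exists (d / 2) => // e e0 ed; rewrite (xd (d / 2))// xd//.
exact: lt_trans d2d.
Qed.

Lemma near_limit_group x :
  stabilizes x -> \forall e \near 0^'+, rotation_group e x = limit_group x.
Proof.
move=> [d d0 xd].
have xE : \forall e \near (0 : R)^'+, rotation_group e x = rotation_group d x.
  by near=> e; apply: xd; near: e; [exact: nbhs_right_gt|exact: nbhs_right_lt].
by rewrite (limit_groupE xE).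
Unshelve. all: by end_near. Qed.

End limit_groups.

(** The groups shrink with the scale. For small [e] the group at [y] lies inside some group at [x]
    equal to [H], and it contains a group at [x] of still smaller scale, again equal to [H]. *)
Lemma near_rotation_group_interleave (R : realType) (m : nat)
    (X Y : substitution_system R m) (x : X) (y : Y) H :
  (forall e : R, 0 < e ->
     exists2 d, 0 < d & rotation_group d x `<=` rotation_group e y) ->
  (forall e : R, 0 < e ->
     exists2 d, 0 < d & rotation_group d y `<=` rotation_group e x) ->
  (\forall e \near 0^'+, rotation_group e x = H) ->
  \forall e \near 0^'+, rotation_group e y = H.
Proof.
move=> xy yx xH.
have [c [c0 cH]] : exists c : R, 0 < c /\ rotation_group c x = H.
  apply: (@filter_ex _ (0^'+)); near=> c; split; near: c => //.
  exact: nbhs_right_gt.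
have [d d0 dc] := yx c c0.
near=> e.
have e0 : 0 < e by near: e; exact: nbhs_right_gt.
have ed : e <= d by near: e; exact: nbhs_right_le.
apply/seteqP; split.
  by rewrite -cH; apply: subset_trans dc; exact: rotation_groupS.
have [b b0 be] := xy e e0.
have [a [ab <-]] : exists a : R, a <= b /\ rotation_group a x = H.
  apply: (@filter_ex _ (0^'+)); near=> a; split; near: a => //.
  exact: nbhs_right_le.
by apply: subset_trans be; exact: rotation_groupS.
Unshelve. all: by end_near. Qed.

(** * Null sets and almost everywhere statements *)

Section null_sets.
Context (R : realType) (m : nat) (X : substitution_system R m).
Implicit Types (N M : set X) (P Q : X -> Prop).

Lemma null_setS N M : N `<=` M -> null_set M -> null_set N.
Proof.
by move=> NM M0 mu mui; apply: (@negligibleS _ (borel_type X) _ mu) NM _; exact: M0.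
Qed.

Lemma null_setU N M : null_set N -> null_set M -> null_set (N `|` M).
Proof.
move=> N0 M0 mu mui; apply: (@negligibleU _ (borel_type X) _ mu); first exact: N0.
exact: M0.
Qed.

Lemma almost_every_sub P Q :
  (forall x, P x -> Q x) -> almost_every P -> almost_every Q.
Proof. by move=> PQ; apply: null_setS => x nQx /PQ. Qed.

Lemma almost_every_and P Q :
  almost_every P -> almost_every Q -> almost_every (fun x => P x /\ Q x).
Proof.
move=> aP aQ; apply: null_setS (null_setU aP aQ) => x /= /not_andP[|];
  by [left|right].
Qed.

Lemma almost_every_notin N : null_set N -> almost_every (fun x => ~ N x).
Proof. by apply: null_setS => x /contrapT. Qed.

Lemma borel_act (g : euclid R m) (A : set X) :
  borel A -> borel (act g @^-1` A).
Proof.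
have mg : measurable_fun (U := borel_type X) (T := borel_type X) setT (act g).
  apply: (@measurability _ _ (borel_type X) (borel_type X) setT (act g)
    (@open X)) => // _ [B oB <-].
  rewrite setTI; apply: sub_gen_smallest; move: B oB; apply/continuousP => x.
  apply: (@continuous_comp _ _ _ (fun x => (g, x))
    (fun gx : euclid R m * X => act gx.1 gx.2)); last exact: act_continuous.
  exact: (cvg_pair (cvg_cst g) cvg_id).
by move=> bA; rewrite -[X in borel X]setTI; exact: mg.
Qed.

End null_sets.

(** * Pulling null sets back along almost everywhere equivariant maps *)

Section pushforward.
Context (R : realType) (m : nat) (X Y : substitution_system R m).
Variables (N : set X) (f : X -> Y).
Hypothesis N0 : null_set N.
Hypothesis fborel :
  forall B, borel B -> strace (@borel X) (~` N) (~` N `&` f @^-1` B).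
Hypothesis fact : forall g x, ~ N x -> f (act g x) = act g (f x).

Lemma null_set_preimage (F : set Y) : null_set F -> null_set (f @^-1` F).
Proof.
move=> F0 mu mui.
have [M [bM M0 NM]] := N0 mui.
(* [M] is a Borel [mu]-null set containing [N]; off [M], [f] is unchanged and both hypotheses on it
   apply. *)
pose h x := if x \in M then point else f x.
have hE B : h @^-1` B = (f @^-1` B `\` M) `|` [set x | M x /\ B point].
  apply/seteqP; split=> x; rewrite /h /=; have [/set_mem Mx|/negP Mx] := boolP (x \in M).
  - by right.
  - by move=> Bx; left; split=> // /mem_set.
  - by case=> [[]|[]].
  - by case=> [[]|[/mem_set]].
have mh : measurable_fun (T := borel_type X) (U := borel_type Y) setT h.
  move=> _ B bB; rewrite setTI hE; apply: measurableU.
    (* The Borel set [A] agrees with the preimage under [f] off [N], hence off [M]. *)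
    have [A bA /seteqP[AE EA]] := fborel bB.
    rewrite (_ : _ `\` M = A `\` M); first exact: measurableD.
    apply/seteqP; split=> x [Ax Mx]; split=> //.
      by have [] := EA x; first split=> // /NM.
    by have [] := AE x; first split=> // /NM.
  have [Bp|nBp] := pselect (B point).
    by rewrite (_ : [set _ | _] = M)//; apply/seteqP; split=> x // [].
  by rewrite (_ : [set _ | _] = set0)//; apply/seteqP; split=> x // [].
have hb A : borel A -> borel (h @^-1` A).
  by move=> bA; rewrite -[X in borel X]setTI; exact: mh.
pose h' : {mfun borel_type X >-> borel_type Y} := mfun_Sub (mem_set mh).
have nui : translation_invariant (distribution mu h').
  move=> t B bB; rewrite /distribution /pushforward /=.
  have bgB : borel (act (translation t) @^-1` B) by exact: borel_act.
  rewrite -[RHS](mui t _ (hb _ bB)).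
  (* Off [Z] both [x] and its translate avoid [M], so [h] commutes with the translation there.
     Invariance of [mu] makes [Z] null, so adjoining [Z] to the two sets to be compared keeps their
     measures. *)
  pose Z := M `|` act (translation t) @^-1` M.
  have bgM : borel (act (translation t) @^-1` M) by exact: borel_act.
  have bZ : borel Z by exact: (@measurableU _ (borel_type X)).
  have Z0 : mu Z = 0%E by apply: null_set_setU => //; exact: etrans (mui t M bM) M0.
  have muZ A : borel A -> mu (A `|` Z) = mu A.
    by move=> bA; exact: (@measureU0 _ (borel_type X) _ mu _ _ bA bZ Z0).
  rewrite -[LHS](muZ _ (hb _ bgB)) -[RHS](muZ _ (borel_act _ (hb _ bB))).
  have hact x : ~ Z x -> h (act (translation t) x) = act (translation t) (h x).
    move=> /not_orP[/= nMx nMgx]; rewrite /h.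
    by rewrite !(memNset _)// fact// => /NM.
  congr (mu _); apply/seteqP; split=> x [] //= hx; try by right.
    by have [Zx|/hact hxE] := pselect (Z x); [right|left; rewrite hxE].
  by have [Zx|/hact hxE] := pselect (Z x); [right|left; rewrite -hxE].
have [B [bB B0 FB]] := F0 _ nui.
exists (M `|` h @^-1` B); split.
- by apply: measurableU => //; exact: hb.
- apply: null_set_setU => //; exact: hb.
- move=> x Fx; have [Mx|nMx] := pselect (M x); [by left|right].
  by rewrite /= /h; case: ifPn => [/set_mem//|_]; exact: FB.
Qed.

End pushforward.

(** * Transfer of null sets and limit groups along an equivalence *)

Section equivalent_systems.
Context (R : realType) (m : nat) (X1 X2 : substitution_system R m).
Variables (Y1 : set X1) (Y2 : set X2) (tau : X1 -> X2).
Hypothesis equiv : equivalence Y1 Y2 tau.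

Lemma null_set_tau_preimage (F : set X2) :
  null_set F -> null_set (tau @^-1` F).
Proof.
have [tauY _ _] := equiv_bij equiv.
apply: (null_set_preimage (equiv_nulll equiv)) => [B bB|g x].
  (* Cutting [B] down to the complement of [Y2] leaves the preimage off [Y1] unchanged, as [tau]
     maps the one complement into the other. *)
  have := equiv_borel equiv (B := B `&` ~` Y2).
  rewrite (_ : ~` Y1 `&` tau @^-1` (B `&` ~` Y2) = ~` Y1 `&` tau @^-1` B).
    by apply; exists B.
  by apply/seteqP; split=> x [Y1x] => [[]|Bx]; split=> //; split=> //; exact: tauY.
exact: (equiv_act equiv).
Qed.

(** The image lies in the preimage of [E] under an inverse [s] of [tau], arbitrary on [Y2], and
    [null_set_preimage] applies to [s]. *)
Lemma null_set_tau_image (E : set X1) :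
  null_set E -> null_set (tau @` (E `\` Y1)).
Proof.
move=> E0; have [tauY tauI tauS] := equiv_bij equiv.
have [s sP] : {s : X2 -> X1 & forall y, ~ Y2 y -> ~ Y1 (s y) /\ tau (s y) = y}.
  apply: (@choice _ _ (fun y x => ~ Y2 y -> ~ Y1 x /\ tau x = y)) => y.
  have [Y2y|nY2y] := pselect (Y2 y); first by exists point.
  by have [x Y1x <-] := tauS y nY2y; exists x.
have sK x : ~ Y1 x -> s (tau x) = x.
  move=> Y1x; have [Y1s tauE] := sP _ (tauY _ Y1x).
  by apply: tauI => //; exact: mem_set.
have sborel A : borel A -> strace (@borel X2) (~` Y2) (~` Y2 `&` s @^-1` A).
  move=> bA; have := equiv_borelV equiv (A := A `&` ~` Y1).
  rewrite (_ : tau @` (A `&` ~` Y1) = ~` Y2 `&` s @^-1` A).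
    by apply; exists A.
  apply/seteqP; split=> [_ [x [Ax Y1x] <-]|y [Y2y Ay]].
    by split; [exact: tauY|rewrite /= sK].
  by have [Y1s tauE] := sP y Y2y; exists (s y).
have sact g y : ~ Y2 y -> s (act g y) = act g (s y).
  move=> Y2y; have [Y1s tauE] := sP y Y2y.
  (* Cancelling [s] against [tau] requires [act g (s y)] to avoid [Y1]; otherwise acting by the
     inverse of [g] would put [s y] in [Y1]. *)
  rewrite -{1}tauE -(equiv_act equiv)// sK// => /(equiv_invl equiv g^-1%g).
  by rewrite -actM mulVg act1.
apply: null_setS (null_set_preimage (equiv_nullr equiv) sborel sact E0).
by move=> _ [x [Ex Y1x] <-] /=; rewrite sK.
Qed.

(** By equivariance the same pair [(r, t)] witnesses [r] at [x] and at [tau x]; invariance of [Y1]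
    keeps the moved point where [tau] is controlled. *)
Lemma rotation_group_tau x (e : R) : ~ Y1 x -> 0 < e ->
  exists2 d, 0 < d & rotation_group d x `<=` rotation_group e (tau x).
Proof.
move=> Y1x e0; have [d [_ [d0 _ dP _]]] := equiv_stable equiv Y1x e0 e0.
exists d => //; apply: generatedS => r [t rtx]; exists t.
rewrite -(equiv_act equiv)//; apply: dP; exists (act (Euclid r t) x) => //.
split=> // /(equiv_invl equiv (Euclid r t : euclid R m)^-1%g).
by rewrite -actM mulVg act1.
Qed.

Lemma rotation_group_tauV x (e : R) : ~ Y1 x -> 0 < e ->
  exists2 d, 0 < d & rotation_group d (tau x) `<=` rotation_group e x.
Proof.
move=> Y1x e0; have [_ [d [_ d0 _ dP]]] := equiv_stable equiv Y1x e0 e0.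
exists d => //; apply: generatedS => r [t rtx]; exists t.
apply: dP; split; last by rewrite /= (equiv_act equiv).
move=> /(equiv_invl equiv (Euclid r t : euclid R m)^-1%g).
by rewrite -actM mulVg act1.
Qed.

Lemma limit_group_tau x : ~ Y1 x -> stabilizes x ->
  stabilizes (tau x) /\ limit_group (tau x) = limit_group x.
Proof.
move=> Y1x /near_limit_group xE.
have tauE : \forall e \near 0^'+, rotation_group e (tau x) = limit_group x.
  by apply: near_rotation_group_interleave xE => e e0;
    [exact: rotation_group_tau|exact: rotation_group_tauV].
by split; [exact: stabilizes_near tauE|exact: limit_groupE].
Qed.

(** By surjectivity, a point off [Y2] where [Q] fails is the image of a point off [Y1] where [P]
    fails. *)
Lemma almost_every_tau (P : X1 -> Prop) (Q : X2 -> Prop) :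
  (forall x, ~ Y1 x -> P x -> Q (tau x)) -> almost_every P -> almost_every Q.
Proof.
move=> PQ aP; have [_ _ tauS] := equiv_bij equiv.
apply: null_setS (null_setU (equiv_nullr equiv) (null_set_tau_image aP)).
move=> y nQy; have [Y2y|nY2y] := pselect (Y2 y); [by left|right].
by have [x Y1x xy] := tauS y nY2y; exists x => //; split=> // Px;
  apply: nQy; rewrite /= -xy; exact: PQ.
Qed.

End equivalent_systems.

Theorem theorem3 (R : realType) (m : nat) (X1 X2 : substitution_system R m)
    (Y1 : set X1) (Y2 : set X2) (tau : X1 -> X2) :
  equivalence Y1 Y2 tau ->
  property_P X1 ->
  [/\ property_P X2,
      almost_every (fun x : X1 =>
        [/\ ~ Y1 x, stabilizes (tau x) & limit_group (tau x) = limit_group x]) &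
      ae_constant (fun x : X1 => conjugacy_class (limit_group x)) ->
        [/\ ae_constant (fun x : X1 => conjugacy_class (limit_group (tau x))),
            ae_constant (fun y : X2 => conjugacy_class (limit_group y)) &
            rotation_class X2 = rotation_class X1]].
Proof.
move=> equiv P1.
have aeE : almost_every (fun x : X1 =>
    [/\ ~ Y1 x, stabilizes (tau x) & limit_group (tau x) = limit_group x]).
  have := almost_every_and (almost_every_notin (equiv_nulll equiv)) P1.
  apply: almost_every_sub => x [Y1x /(limit_group_tau equiv Y1x)[]].
  by split.
(* For each fixed [C] the statement transfers both ways, so the two sets under [get] in
   [rotation_class] are equal. *)
have classE (C : set (set (rotation R m))) :
    almost_every (fun x : X1 => conjugacy_class (limit_group x) = C) <->
    almost_every (fun y : X2 => conjugacy_class (limit_group y) = C).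
  split=> [aC|/(null_set_tau_preimage equiv) aC].
    apply: (almost_every_tau equiv) (almost_every_and aeE aC).
    by move=> x _ [[_ _ ->]].
  apply: almost_every_sub (almost_every_and aeE aC).
  by move=> x [[_ _ <-]].
split=> //.
  by apply: (almost_every_tau equiv) P1 => x Y1x /(limit_group_tau equiv Y1x)[].
move=> [C aC]; split.
- exists C; apply: almost_every_sub (almost_every_and aeE aC).
  by move=> x [[_ _ ->]].
- by exists C; exact/classE.
- by congr get; apply/seteqP; split=> D /classE.
Qed.
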